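(* The following decision problem (Problem 1) is solvable in $O(n^2k^4)$ time: given a triple of states $(|\psi\rangle,|\varphi\rangle,|\chi\rangle)$, where $|\psi\rangle$ and $|\varphi\rangle$ are $n\times n$ states with $\psi\prec\varphi$ and $|\chi\rangle$ is a $k\times k$ state, determine whether there exists a $k\times k$ state $|\omega\rangle$ such that $\psi\otimes\chi\prec\varphi\otimes\omega$, $\omega\prec\chi$, and $\chi\neq\omega$ (both in non-increasing order).
   Context: An $n\times n$ state is a bipartite pure state in $\mathbb{C}^n\otimes\mathbb{C}^n$, identified here with its Schmidt coefficient vector, a non-increasing $n$-dimensional probability vector: $|\psi\rangle=\sum_i\sqrt{\alpha_i}|i_A\rangle|i_B\rangle$ has $\psi=(\alpha_1,\dots,\alpha_n)$. $\psi\otimes\chi$ is the Kronecker product of vectors. For vectors of the same dimension $N$, $x\prec y$ means that for each $1\le l<N$ the sum of the $l$ largest components of $x$ is at most that of $y$, with equality of the total sums. Input is given by the Schmidt coefficient vectors, and time counts arithmetic operations and comparisons on real numbers, each at unit cost. *)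

(* Defs.v *)
From HB Require Import structures.
From mathcomp Require Import all_boot all_order all_algebra.
From mathcomp Require Import reals.
From mathcomp Require Import mxtens.

Set Implicit Arguments.
Unset Strict Implicit.
Unset Printing Implicit Defensive.

Import Order.TTheory GRing.Theory Num.Theory.
Local Open Scope ring_scope.

Definition nonincreasing (R : realType) (n : nat) (x : 'rV[R]_n) : Prop :=
  forall i j : 'I_n, (i <= j)%N -> x 0 j <= x 0 i.

(* An n x n pure state, given by its vector of Schmidt coefficients (the
   alpha_i, not their square roots).  For n = 0 there is no such vector. *)
Definition schmidt_vector (R : realType) (n : nat) (x : 'rV[R]_n) : Prop :=
  [/\ nonincreasing x, forall i, 0 <= x 0 i & \sum_i x 0 i = 1].

Definition sum_largest (R : realType) (N : nat) (x : 'rV[R]_N) (l : nat) : R :=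
  \sum_(z <- take l (sort >=%R [seq x 0 i | i <- enum 'I_N])) z.

Definition majorized (R : realType) (N : nat) (x y : 'rV[R]_N) : Prop :=
  (forall l : nat, (1 <= l < N)%N -> sum_largest x l <= sum_largest y l)
  /\ \sum_i x 0 i = \sum_i y 0 i.

Notation "x '≺' y" := (majorized x y) (at level 70, no associativity).

(* The Kronecker product [*t] of two row vectors has type 'M_(1 * 1, n * k),
   which is convertible to 'rV_(n * k). *)
Definition kron (R : realType) (n k : nat) (x : 'rV[R]_n) (y : 'rV[R]_k) :
  'rV[R]_(n * k) := x *t y.

Definition recoverable (R : realType) (n k : nat)
    (psi phi : 'rV[R]_n) (chi : 'rV[R]_k) : Prop :=
  exists omega : 'rV[R]_k,
    [/\ schmidt_vector omega, kron psi chi ≺ kron phi omega,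
        omega ≺ chi & chi <> omega].

(* The model of computation is a real RAM, programmed in a structured
   three-address language.  The machine has natural-number registers, used for
   indexing and control, and unbounded arrays of exact real numbers, accessed
   through the registers.  The operand (a, r) designates the entry of array a
   whose index is the content of register r. *)
Definition operand : Type := (nat * nat)%type.

Inductive real_op := RAdd | RSub | RMul | RDiv.

Inductive test :=
  | RealLe of operand & operand
  | IndexLt of nat & nat.

(* The only real literals are natural numbers, so that a program is a finite
   object that cannot hide information in a constant. *)
Inductive program :=
  | Skip
  | Seq of program & program
  | IndexConst of nat & nat
  | IndexAdd of nat & nat & nat
  | IndexSub of nat & nat & nat
  | RealConst of operand & nat
  | RealOp of real_op & operand & operand & operand
  | If of test & program & program
  | While of test & program.

Record state (R : realType) := State {
  reg : nat -> nat;
  arr : nat -> nat -> R }.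

Section Semantics.
Variable R : realType.
Implicit Types (s : state R) (o d : operand).

Definition read s o : R := arr s o.1 (reg s o.2).

Definition set_reg s (r v : nat) : state R :=
  State (fun q => if q == r then v else reg s q) (arr s).

Definition write s d (v : R) : state R :=
  State (reg s)
        (fun a i => if (a == d.1) && (i == reg s d.2) then v else arr s a i).

(* Division is total, with x / 0 = 0. *)
Definition eval_op (f : real_op) (x y : R) : R :=
  match f with
  | RAdd => x + y
  | RSub => x - y
  | RMul => x * y
  | RDiv => x / y
  end.

Definition eval_test s (b : test) : bool :=
  match b with
  | RealLe o1 o2 => read s o1 <= read s o2
  | IndexLt r1 r2 => (reg s r1 < reg s r2)%N
  end.

(* exec p s t s' : started in s, the program p halts in s' after t steps.
   Every instruction and every evaluation of a test is a step; in particular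
   each arithmetic operation and each comparison on reals is one.  IndexSub is
   truncated subtraction. *)
Inductive exec : program -> state R -> nat -> state R -> Prop :=
  | ExecSkip s : exec Skip s 1 s
  | ExecSeq p1 p2 s1 s2 s3 t1 t2 :
      exec p1 s1 t1 s2 -> exec p2 s2 t2 s3 ->
      exec (Seq p1 p2) s1 (t1 + t2) s3
  | ExecIndexConst r m s : exec (IndexConst r m) s 1 (set_reg s r m)
  | ExecIndexAdd r r1 r2 s :
      exec (IndexAdd r r1 r2) s 1 (set_reg s r (reg s r1 + reg s r2)%N)
  | ExecIndexSub r r1 r2 s :
      exec (IndexSub r r1 r2) s 1 (set_reg s r (reg s r1 - reg s r2)%N)
  | ExecRealConst d m s : exec (RealConst d m) s 1 (write s d m%:R)
  | ExecRealOp f d o1 o2 s :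
      exec (RealOp f d o1 o2) s 1 (write s d (eval_op f (read s o1) (read s o2)))
  | ExecIfTrue b p1 p2 s s' t :
      eval_test s b -> exec p1 s t s' -> exec (If b p1 p2) s t.+1 s'
  | ExecIfFalse b p1 p2 s s' t :
      ~~ eval_test s b -> exec p2 s t s' -> exec (If b p1 p2) s t.+1 s'
  | ExecWhileTrue b p s1 s2 s3 t1 t2 :
      eval_test s1 b -> exec p s1 t1 s2 -> exec (While b p) s2 t2 s3 ->
      exec (While b p) s1 (t1 + t2).+1 s3
  | ExecWhileFalse b p s : ~~ eval_test s b -> exec (While b p) s 1 s.

Definition entry (n : nat) (x : 'rV[R]_n) (i : nat) : R :=
  if insub i is Some j then x 0 j else 0.

(* Input convention: n and k in registers 0 and 1, the Schmidt vectors psi,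
   phi and chi in arrays 0, 1 and 2, and zeros everywhere else. *)
Definition input (n k : nat) (psi phi : 'rV[R]_n) (chi : 'rV[R]_k) : state R :=
  State (fun r => match r with 0 => n | 1 => k | _ => 0 end)%N
        (fun a i => match a with
                    | 0 => entry psi i
                    | 1 => entry phi i
                    | 2 => entry chi i
                    | _ => 0
                    end).

Definition accepts s : Prop := reg s 0 = 1%N.

End Semantics.

(* Main.v *)
(* The set of admissible omega is closed upwards, below chi, for majorization.
   Hence if some omega works then so does, for every small e > 0, the vector
   obtained from chi by transferring e from entry b to entry b + 1, where b is
   any index with chi_b > chi_(b+1) at which the prefix sums of omega and chi
   differ; such b exist.  It remains to test k - 1 infinitesimal transfers.
   Majorization x ≺ y of vectors with equal sums amounts to
   sum_i (x_i - t)^+ <= sum_i (y_i - t)^+ for the entries t of y, so that no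
   sorting is needed, and for a transfer of infinitesimal size e every quantity
   involved is p + q e, a pair (p, q) compared lexicographically.  With n k
   thresholds and sums of n k terms this takes O(n^2 k^3) steps in all. *)
Require Import Defs.
From mathcomp Require Import all_boot all_order all_algebra.
From mathcomp Require Import reals mxtens ring lra zify.

Set Implicit Arguments.
Unset Strict Implicit.
Unset Printing Implicit Defensive.

Import Order.TTheory GRing.Theory Num.Theory.

(** * Majorization through sums of excesses over a threshold, and Kronecker products *)

Section Majorization.
Local Open Scope ring_scope.
Variable R : realType.

Definition hinge (N : nat) (x : 'rV[R]_N) (t : R) : R :=
  \sum_i Num.max 0 (x 0 i - t).

Lemma sum_const_take (s : seq R) (l : nat) (t : R) :
  (l <= size s)%N -> t *+ l = \sum_(z <- take l s) t.
Proof.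
by move=> ls; rewrite big_const_seq count_predT size_takel // iter_addr_0.
Qed.

(** Each kept term [z] is at most [t] plus its excess over [t], and the dropped terms have
    nonnegative excess. *)
Lemma sum_take_le_hinge (s : seq R) (l : nat) (t : R) :
  (l <= size s)%N ->
  \sum_(z <- take l s) z <= t *+ l + \sum_(z <- s) Num.max 0 (z - t).
Proof.
move=> ls; rewrite (sum_const_take t ls).
rewrite -[in X in _ <= _ + X](cat_take_drop l s) big_cat addrA -big_split /=.
apply: ler_wpDr; first by apply: sumr_ge0 => z _; rewrite le_max lexx.
by apply: ler_sum => z _; rewrite -lerBlDl le_max lexx orbT.
Qed.

(** The previous bound is tight when [t] separates the kept terms from the dropped ones: the former
    equal [t] plus their excess, the latter have none. *)
Lemma sum_take_eq_hinge (s : seq R) (l : nat) (t : R) :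
  (l <= size s)%N -> all (>= t) (take l s) -> all (<= t) (drop l s) ->
  \sum_(z <- take l s) z = t *+ l + \sum_(z <- s) Num.max 0 (z - t).
Proof.
move=> ls /allP lo /allP hi; rewrite (sum_const_take t ls).
rewrite -[in X in _ = _ + X](cat_take_drop l s) big_cat addrA -big_split /=.
rewrite [X in _ = _ + X]big1_seq ?addr0; last first.
  by move=> z /andP[_ /hi zt]; apply/max_idPl; rewrite subr_le0.
apply: eq_big_seq => z /lo tz.
by rewrite max_r ?subr_ge0 // addrC subrK.
Qed.

Let values N (x : 'rV[R]_N) := sort >=%R [seq x 0 i | i <- enum 'I_N].

Let sorted_values N (x : 'rV[R]_N) : pairwise >=%R (values x).
Proof.
rewrite -sorted_pairwise; first by apply: sort_sorted => a b; exact: le_total.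
exact: ge_trans.
Qed.

Let size_values N (x : 'rV[R]_N) : size (values x) = N.
Proof. by rewrite size_sort size_map size_enum_ord. Qed.

Let sum_values N (x : 'rV[R]_N) (f : R -> R) :
  \sum_(z <- values x) f z = \sum_i f (x 0 i).
Proof.
by rewrite (perm_big _ (permEl (perm_sort _ _))) big_map big_enum.
Qed.

Lemma sum_largest_le_hinge N (x : 'rV[R]_N) (l : nat) (t : R) :
  (l <= N)%N -> sum_largest x l <= t *+ l + hinge x t.
Proof.
move=> lN; rewrite /hinge -(sum_values x (fun z => Num.max 0 (z - t))).
by apply: sum_take_le_hinge; rewrite size_values.
Qed.

(** The right [l] counts the entries above [t]: it is the first position in the sorted list whose
    value is at most [t]. *)
Lemma hinge_attained N (x : 'rV[R]_N) (t : R) :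
  exists2 l, (l <= N)%N & sum_largest x l = t *+ l + hinge x t.
Proof.
pose l := find (<= t) (values x).
have lN : (l <= size (values x))%N by exact: find_size.
exists l; first by rewrite -(size_values x).
rewrite /hinge -(sum_values x (fun z => Num.max 0 (z - t))).
apply: sum_take_eq_hinge => //.
  apply/(all_nthP 0) => i; rewrite size_takel // => il.
  rewrite nth_take //=; apply: ltW; rewrite ltNge.
  by have /= -> := before_find 0 il.
apply/(all_nthP 0) => i; rewrite size_drop ltn_subRL nth_drop => il.
have hl : has (<= t) (values x).
  by rewrite has_find; apply: leq_ltn_trans il; exact: leq_addr.
have /= := nth_find 0 hl; rewrite -/l; apply: le_trans.
case: i il => [|i] il; first by rewrite addn0.
have /(pairwiseP 0) mono := sorted_values x.
apply: mono => //; last by rewrite addnS ltnS leq_addr.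
by rewrite inE -has_find.
Qed.

(** The [l]-th largest entry serves as threshold. This is why finitely many thresholds suffice to
    test majorization. *)
Lemma sum_largest_attained N (x : 'rV[R]_N) (l : nat) :
  (0 < l <= N)%N -> exists i, sum_largest x l = x 0 i *+ l + hinge x (x 0 i).
Proof.
case: l => // l /= lN.
have lv : (l < size (values x))%N by rewrite size_values.
have : nth 0 (values x) l \in values x by exact: mem_nth.
rewrite mem_sort => /mapP[i _ ti]; exists i; rewrite -ti.
rewrite /hinge -(sum_values x (fun z => Num.max 0 (z - _))).
have /(pairwiseP 0) mono := sorted_values x.
apply: sum_take_eq_hinge => //.
  apply/(all_nthP 0) => j; rewrite size_takel // ltnS => jl.
  rewrite nth_take //; case: (ltngtP j l) jl => // [jl|->] _; last exact: lexx.
  by apply: mono => //; rewrite inE (ltn_trans jl).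
apply/(all_nthP 0) => j; rewrite size_drop ltn_subRL nth_drop => jl.
by apply: mono => //; rewrite addSn ltnS leq_addr.
Qed.

Lemma sum_largest0 N (x : 'rV[R]_N) : sum_largest x 0 = 0.
Proof. by rewrite /sum_largest take0 big_nil. Qed.

Lemma sum_largest_full N (x : 'rV[R]_N) : sum_largest x N = \sum_i x 0 i.
Proof. by rewrite /sum_largest take_oversize ?size_values // sum_values. Qed.

(** By the two preceding bounds, [hinge x t] is the maximum over [l] of [sum_largest x l - t *+ l],
    so it is enough to compare [x] and [y] at the [l] that is optimal for [x]. *)
Lemma majorized_hinge N (x y : 'rV[R]_N) (t : R) :
  x ≺ y -> hinge x t <= hinge y t.
Proof.
move=> [le_l eq_s]; have [l lN lx] := hinge_attained x t.
have : sum_largest x l <= t *+ l + hinge y t.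
  apply: le_trans (sum_largest_le_hinge y t lN).
  (* The ends [l = 0] and [l = N] lie outside the range covered by [majorized]; the second follows
     from the equality of totals. *)
  case: (posnP l) => [->|l0]; first by rewrite !sum_largest0.
  case: (ltngtP l N) lN => // [lN|->] _; first by apply: le_l; rewrite l0.
  by rewrite !sum_largest_full eq_s.
by rewrite lx lerD2l.
Qed.

(** Dually, for [l > 0], [sum_largest y l] is the minimum over [t] of [t *+ l + hinge y t], attained
    at an entry of [y]. *)
Lemma hinge_majorized N (x y : 'rV[R]_N) :
  \sum_i x 0 i = \sum_i y 0 i ->
  (forall i, hinge x (y 0 i) <= hinge y (y 0 i)) -> x ≺ y.
Proof.
move=> eq_s le_h; split=> // l /andP[l0 lN].
have [|i ->] := @sum_largest_attained N y l; first by rewrite l0 ltnW.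
by apply: le_trans (sum_largest_le_hinge x (y 0 i) (ltnW lN)) _; rewrite lerD2l.
Qed.

Lemma sum_kron n k (x : 'rV[R]_n) (y : 'rV[R]_k) (f : R -> R) :
  \sum_i f (kron x y 0 i) = \sum_i \sum_j f (x 0 i * y 0 j).
Proof.
rewrite pair_big /=.
rewrite (reindex (@mxtens_index n k)) /=; last first.
  exists (@mxtens_unindex n k) => i _; first exact: mxtens_indexK.
  exact: mxtens_unindexK.
apply: eq_bigr => -[i j] _ /=; congr f.
rewrite -[LHS]/((x *t y) 0 (mxtens_index (i, j))) -tensmxE.
(* Only the row indices differ, [0] against [mxtens_index (0, 0)]; both have value 0. *)
by congr (fun_of_matrix _ _ _); exact: val_inj.
Qed.

Lemma hinge_kron n k (x : 'rV[R]_n) (y : 'rV[R]_k) (t : R) :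
  hinge (kron x y) t = \sum_i \sum_j Num.max 0 (x 0 i * y 0 j - t).
Proof. exact: (sum_kron x y (fun z => Num.max 0 (z - t))). Qed.

Lemma sum_kronE n k (x : 'rV[R]_n) (y : 'rV[R]_k) :
  \sum_i kron x y 0 i = (\sum_i x 0 i) * (\sum_j y 0 j).
Proof.
rewrite (sum_kron x y id) mulr_suml.
by apply: eq_bigr => i _; rewrite mulr_sumr.
Qed.

(** A nonzero factor [x 0 i] can be pulled out of its row, which leaves a comparison of [y] and [z]
    at threshold [t / x 0 i]; when the factor is zero the two rows coincide. *)
Lemma hinge_kron_le n k (x : 'rV[R]_n) (y z : 'rV[R]_k) (t : R) :
  (forall i, 0 <= x 0 i) -> y ≺ z -> hinge (kron x y) t <= hinge (kron x z) t.
Proof.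
move=> x0 yz; rewrite !hinge_kron; apply: ler_sum => i _.
have [xi0|xi0] := eqVneq (x 0 i) 0.
  rewrite le_eqVlt; apply/orP; left; apply/eqP/eq_bigr => j _.
  by rewrite xi0 !mul0r.
have scale (w : 'rV[R]_k) :
    \sum_j Num.max 0 (x 0 i * w 0 j - t) = x 0 i * hinge w (t / x 0 i).
  rewrite mulr_sumr; apply: eq_bigr => j _.
  by rewrite maxr_pMr // mulr0 mulrBr [x 0 i * (t / _)]mulrC divfK.
by rewrite !scale ler_wpM2l // majorized_hinge.
Qed.

(** This lets a suitable omega be replaced by any vector that majorizes it. *)
Lemma majorized_kron_trans n k (x : 'rV[R]_(n * k)) (y : 'rV[R]_n)
    (z w : 'rV[R]_k) :
  (forall i, 0 <= y 0 i) -> x ≺ kron y z -> z ≺ w -> x ≺ kron y w.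
Proof.
move=> y0 xyz zw; apply: hinge_majorized => [|i].
  by case: xyz => _ ->; rewrite !sum_kronE; case: zw => _ ->.
by apply: le_trans (hinge_kron_le _ y0 zw); exact: majorized_hinge.
Qed.

Definition prefix_sum (k : nat) (x : 'rV[R]_k) (l : nat) : R :=
  \sum_(i < k | (i < l)%N) x 0 i.

Lemma sum_largest_nonincreasing k (x : 'rV[R]_k) (l : nat) :
  nonincreasing x -> sum_largest x l = prefix_sum x l.
Proof.
move=> sx; rewrite /sum_largest sorted_sort; last 2 first.
- exact: ge_trans.
- rewrite sorted_map; apply: (@sub_sorted _ (fun i j : 'I_k => (i <= j)%N)).
    by move=> i j /sx.
  have := iota_sorted 0 k; rewrite -val_enum_ord sorted_map.
  by apply: sub_sorted.
have [kl|lk] := leqP k l.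
  rewrite take_oversize; last by rewrite size_map size_enum_ord.
  rewrite big_map big_enum.
  by apply: eq_bigl => i; rewrite (leq_trans (ltn_ord i)).
rewrite -map_take big_map /prefix_sum -[RHS]big_filter; congr bigop.
apply: (inj_map val_inj); rewrite map_take val_enum_ord take_iota.
rewrite /index_enum -enumT -(filter_map _ (fun i => i < l)%N) val_enum_ord.
by rewrite (minn_idPl (ltnW lk)) (@filter_iota_ltn 0) // ltnW.
Qed.

End Majorization.

(** * Signs of first-order expressions in an infinitesimal *)

Section Infinitesimals.
Local Open Scope ring_scope.
Variable R : realType.

(* A pair (p, q) stands for p + q e with e a positive infinitesimal. *)
Definition lex_nneg (p : R * R) : bool :=
  (0 < p.1) || ((p.1 == 0) && (0 <= p.2)).

Definition lex_pos_part (p : R * R) : R * R := if lex_nneg p then p else 0.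

Definition at_eps (e : R) (p : R * R) : R := p.1 + e * p.2.

Lemma at_epsB e p q : at_eps e (p - q) = at_eps e p - at_eps e q.
Proof. by rewrite /at_eps /=; ring. Qed.

Lemma at_eps_sum e (I : Type) (r : seq I) (P : pred I) (F : I -> R * R) :
  at_eps e (\sum_(i <- r | P i) F i) = \sum_(i <- r | P i) at_eps e (F i).
Proof.
apply: (big_morph (at_eps e)) => [p q|]; last by rewrite /at_eps /= mulr0 addr0.
by rewrite /at_eps /=; ring.
Qed.

Lemma lex_nneg_at_eps (p : R * R) :
  exists2 e0, 0 < e0 &
    forall e, 0 < e -> e <= e0 -> (0 <= at_eps e p) = lex_nneg p.
Proof.
case: p => p q; rewrite /lex_nneg /at_eps /=.
have q1 : 0 < `|q| + 1 by rewrite ltr_wpDl.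
have [p0|p0|<-] := ltgtP 0 p.
(* This bound, and its mirror image in the next case, keeps [e * |q|] below [|p|], so that the sign
   of [p] decides. *)
- exists (p / (2 * (`|q| + 1))); first by rewrite divr_gt0 // mulr_gt0.
  move=> e e0; rewrite ler_pdivlMr ?mulr_gt0 // => le_e.
  have := ler_norm (- (e * q)); rewrite normrN normrM gtr0_norm //.
  by nra.
- exists (- p / (2 * (`|q| + 1))).
    by rewrite divr_gt0 ?oppr_gt0 // mulr_gt0.
  move=> e e0; rewrite ler_pdivlMr ?mulr_gt0 // => le_e; apply/negbTE.
  rewrite -ltNge; have := ler_norm (e * q); rewrite normrM gtr0_norm //.
  by nra.
- by exists 1 => // e e0 _; rewrite add0r pmulr_rge0.
Qed.

Lemma lex_nneg_at_eps_fin (I : finType) (f : I -> R * R) :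
  exists2 e0, 0 < e0 & forall e, 0 < e -> e <= e0 ->
    forall i, (0 <= at_eps e (f i)) = lex_nneg (f i).
Proof.
suff [e0 e0_gt0 He] : exists2 e0, 0 < e0 & forall e, 0 < e -> e <= e0 ->
    forall i, i \in enum I -> (0 <= at_eps e (f i)) = lex_nneg (f i).
  by exists e0 => // e e_gt0 ee0 i; apply: He => //; rewrite mem_enum.
elim: (enum I) => [|i s [e1 e1_gt0 He1]]; first by exists 1.
have [e2 e2_gt0 He2] := lex_nneg_at_eps (f i).
exists (Num.min e1 e2); first by rewrite lt_min e1_gt0.
move=> e e_gt0; rewrite le_min => /andP[ee1 ee2] j.
by rewrite inE => /orP[/eqP ->|]; [exact: He2|exact: He1].
Qed.

Lemma at_eps_pos_part e p :
  (0 <= at_eps e p) = lex_nneg p ->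
  at_eps e (lex_pos_part p) = Num.max 0 (at_eps e p).
Proof.
rewrite /lex_pos_part => <-; case: leP => // _.
by rewrite /at_eps /= mulr0 addr0.
Qed.

End Infinitesimals.

(** * Reduction of recoverability to finitely many infinitesimal transfers *)

Section Decision.
Local Open Scope ring_scope.
Variable R : realType.
Implicit Types (x y z : nat -> R).

Definition direction (b j : nat) : R := (j == b.+1)%:R - (j == b)%:R.

Definition source x z (i j : nat) : R * R := (x i * z j, 0).

Definition target y z (b i j : nat) : R * R := (y i * z j, y i * direction b j).

(** The pair [(a, c)] selects the threshold, an entry of the target, and [(i, j)] the summand.
    Summed over [i] and [j], this is the hinge of the target minus that of the source. *)
Definition margin_term x y z (b a c i j : nat) : R * R :=
  lex_pos_part (target y z b i j - target y z b a c) -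
  lex_pos_part (source x z i j - target y z b a c).

Definition margin (n k : nat) x y z (b a c : nat) : R * R :=
  \sum_(0 <= i < n) \sum_(0 <= j < k) margin_term x y z b a c i j.

Definition transfer_ok (n k : nat) x y z (b : nat) : bool :=
  (z b.+1 < z b) &&
  all (fun a => all (fun c => lex_nneg (margin n k x y z b a c)) (iota 0 k))
      (iota 0 n).

Definition recovery_test (n k : nat) x y z : bool :=
  has (transfer_ok n k x y z) (iota 0 k.-1).

Definition transfer (k : nat) (z : 'rV[R]_k) (b : nat) (e : R) : 'rV[R]_k :=
  \row_j (z 0 j + e * direction b j).

Lemma entry_ord n (x : 'rV[R]_n) (i : 'I_n) : entry x i = x 0 i.
Proof. by rewrite /entry valK. Qed.

(** Every prefix contains both ends of the transfer or neither, except the one that stops just after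
    [b]. *)
Lemma prefix_sum_transfer k (z : 'rV[R]_k) (b l : nat) (e : R) :
  (b.+1 < k)%N ->
  prefix_sum (transfer z b e) l = prefix_sum z l - e *+ (l == b.+1).
Proof.
move=> bk; rewrite /prefix_sum.
under eq_bigr do rewrite mxE.
rewrite big_split /= -mulr_sumr; congr (_ + _).
rewrite sumrB.
have pick (c : nat) : (c < k)%N ->
    \sum_(i < k | (i < l)%N) (i == c :> nat)%:R = (c < l)%:R :> R.
  move=> ck; rewrite big_mkcond (bigD1 (Ordinal ck)) //= eqxx.
  rewrite big1 ?addr0 => [|i]; first by case: ifP.
  by rewrite -val_eqE /= => /negbTE ->; case: ifP.
rewrite !pick //; last by rewrite (ltn_trans _ bk).
rewrite [(b < l)%N]leq_eqVlt eq_sym -mulr_natr.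
by case: (ltngtP b.+1 l) => _ /=;
  rewrite ?(subrr, sub0r, mulr0, mulrN, mulr1, oppr0).
Qed.

Lemma prefix_sum_full k (z : 'rV[R]_k) : prefix_sum z k = \sum_i z 0 i.
Proof. by apply: eq_bigl => i; rewrite ltn_ord. Qed.

Lemma prefix_sumS k (z : 'rV[R]_k) (l : nat) (lk : (l < k)%N) :
  prefix_sum z l.+1 = prefix_sum z l + z 0 (Ordinal lk).
Proof.
rewrite /prefix_sum (bigD1 (Ordinal lk)) //= addrC; congr (_ + _).
apply: eq_bigl => i; rewrite ltnS -val_eqE /=.
by case: ltngtP.
Qed.

(* With g the gap between the prefix sums of z and w: if z is constant across
   every b at which g > 0, then g is convex wherever it is positive, so once
   positive it keeps growing, against g = 0 at the end. *)
Lemma strict_gap_exists k (z w : 'rV[R]_k) :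
  nonincreasing z -> nonincreasing w -> w ≺ z -> z <> w ->
  exists b : nat, [/\ (b.+1 < k)%N, entry z b.+1 < entry z b
    & prefix_sum w b.+1 < prefix_sum z b.+1].
Proof.
move=> sz sw wz neq.
pose g l := prefix_sum z l - prefix_sum w l.
have g0 l : (l <= k)%N -> 0 <= g l.
  move=> lk; rewrite subr_ge0; case: wz => le_l eq_s.
  case: (posnP l) => [->|l0]; first by rewrite /prefix_sum !big_pred0.
  case: (ltngtP l k) lk => // [lk|->] _; last by rewrite !prefix_sum_full eq_s.
  by rewrite -!sum_largest_nonincreasing //; apply: le_l; rewrite l0.
have gS l (lk : (l < k)%N) :
    g l.+1 = g l + (z 0 (Ordinal lk) - w 0 (Ordinal lk)).
  by rewrite /g !prefix_sumS; ring.
have gk : g k = 0.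
  by rewrite /g !prefix_sum_full; case: wz => _ ->; rewrite subrr.
have [/existsP[b]|/existsPn flat] := boolP [exists b : 'I_k,
    [&& (b.+1 < k)%N, entry z b.+1 < entry z b & 0 < g b.+1]].
  by case/and3P => ? ?; rewrite subr_gt0; exists b.
case: neq; apply/rowP.
have rise l (lk : (l < k)%N) : 0 < g l ->
    g l <= g l.+1 /\ 0 < z 0 (Ordinal lk) - w 0 (Ordinal lk).
  elim: l lk => [|l IH] lk gl.
    by rewrite /g /prefix_sum !big_pred0 ?subrr ?ltxx in gl.
  have lk' := ltnW lk.
  (* The last increment of the gap is positive: by induction if the gap was already open, and
     otherwise because it opens here. *)
  have d_l : 0 < z 0 (Ordinal lk') - w 0 (Ordinal lk').
    have [/(IH lk')[]//|gl0] := ltP 0 (g l).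
    by move: gl; rewrite gS; have := g0 l (ltnW lk'); lra.
  have := flat (Ordinal lk'); rewrite /= lk gl andbT /=.
  rewrite -(entry_ord z (Ordinal lk)) (entry_ord z (Ordinal lk')) -leNgt.
  rewrite [entry _ _](entry_ord z (Ordinal lk)) (gS _ lk) => zl.
  have := sw (Ordinal lk') (Ordinal lk) (leqnSn l).
  by split; lra.
have zero l : (l <= k)%N -> g l = 0.
  move=> lk; apply/eqP; rewrite eq_le g0 // andbT leNgt; apply/negP => gl.
  suff gd d : (d <= k - l)%N -> 0 < g (l + d)%N.
    by have := gd _ (leqnn _); rewrite subnKC // gk ltxx.
  elim: d => [|d IH] dk; first by rewrite addn0.
  have ldk : (l + d < k)%N by rewrite -ltn_subRL.
  have gld := IH (ltnW dk).
  by rewrite addnS; apply: lt_le_trans gld (rise _ ldk gld).1.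
case=> l lk; apply/eqP; rewrite -subr_eq0; apply/eqP.
have := gS l lk; rewrite !zero // ?(ltnW lk) //.
by rewrite add0r => /esym.
Qed.

Lemma at_eps_target n k (phi : 'rV[R]_n) (chi : 'rV[R]_k) b e
    (i : 'I_n) (j : 'I_k) :
  at_eps e (target (entry phi) (entry chi) b i j) =
  phi 0 i * transfer chi b e 0 j.
Proof. by rewrite /target /at_eps /= !entry_ord mxE; ring. Qed.

(** Once [e] is small enough for the lexicographic signs to be the true ones, positive parts commute
    with evaluation at [e]. *)
Lemma at_eps_margin n k (psi phi : 'rV[R]_n) (chi : 'rV[R]_k) b e
    (a : 'I_n) (c : 'I_k) :
  let y := target (entry phi) (entry chi) b in
  let x := source (entry psi) (entry chi) in
  let t := phi 0 a * transfer chi b e 0 c in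
  (forall (i : 'I_n) (j : 'I_k),
     (0 <= at_eps e (y i j - y a c)) = lex_nneg (y i j - y a c)) ->
  (forall (i : 'I_n) (j : 'I_k),
     (0 <= at_eps e (x i j - y a c)) = lex_nneg (x i j - y a c)) ->
  at_eps e (margin n k (entry psi) (entry phi) (entry chi) b a c) =
  hinge (kron phi (transfer chi b e)) t - hinge (kron psi chi) t.
Proof.
move=> y x t ysgn xsgn; rewrite /margin big_mkord !hinge_kron -sumrB at_eps_sum.
apply: eq_bigr => i _; rewrite big_mkord -sumrB at_eps_sum.
apply: eq_bigr => j _; rewrite at_epsB !at_eps_pos_part ?ysgn ?xsgn //.
rewrite !at_epsB !at_eps_target; congr (_ - Num.max 0 (_ - _)).
by rewrite /at_eps /source /= mulr0 addr0 !entry_ord.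
Qed.

(** One bound on [e] serves all thresholds: [e1] and [e2] settle the signs inside the positive
    parts, [e3] those of the margins themselves. *)
Lemma small_eps n k (psi phi : 'rV[R]_n) (chi : 'rV[R]_k) (b : nat) :
  exists2 e0, 0 < e0 & forall e, 0 < e -> e <= e0 ->
    forall (a : 'I_n) (c : 'I_k),
      lex_nneg (margin n k (entry psi) (entry phi) (entry chi) b a c) =
      (hinge (kron psi chi) (phi 0 a * transfer chi b e 0 c) <=
       hinge (kron phi (transfer chi b e)) (phi 0 a * transfer chi b e 0 c)).
Proof.
pose y := target (entry phi) (entry chi) b.
pose x := source (entry psi) (entry chi).
pose I := (('I_n * 'I_k) * ('I_n * 'I_k))%type.
have [e1 e1_gt0 He1] := lex_nneg_at_eps_fin
  (fun q : I => y q.2.1 q.2.2 - y q.1.1 q.1.2).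
have [e2 e2_gt0 He2] := lex_nneg_at_eps_fin
  (fun q : I => x q.2.1 q.2.2 - y q.1.1 q.1.2).
have [e3 e3_gt0 He3] := lex_nneg_at_eps_fin
  (fun q : 'I_n * 'I_k =>
     margin n k (entry psi) (entry phi) (entry chi) b q.1 q.2).
exists (Num.min e1 (Num.min e2 e3)); first by rewrite !lt_min e1_gt0 e2_gt0.
move=> e e_gt0; rewrite !le_min => /and3P[ee1 ee2 ee3] a c.
rewrite -(He3 e e_gt0 ee3 (a, c)) /= at_eps_margin ?subr_ge0 // => i j.
  exact: (He1 e e_gt0 ee1 ((a, c), (i, j))).
exact: (He2 e e_gt0 ee2 ((a, c), (i, j))).
Qed.

Lemma sum_transfer k (chi : 'rV[R]_k) b e :
  (b.+1 < k)%N -> \sum_j transfer chi b e 0 j = \sum_j chi 0 j.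
Proof.
move=> bk; rewrite -!prefix_sum_full prefix_sum_transfer //.
by rewrite gtn_eqF // subr0.
Qed.

Lemma directionE b j :
  direction b j = if j == b.+1 then 1 else if j == b then -1 else 0.
Proof.
rewrite /direction; case: (eqVneq j b.+1) => [->|_]; last first.
  by case: eqP; rewrite ?sub0r ?oppr0.
by rewrite gtn_eqF // subr0.
Qed.

(** Among gaps between neighbours only the one at [b] shrinks, by [2 * e]. The bound on [e] is
    phrased with [at_eps] so that [lex_nneg_at_eps] provides it. *)
Lemma nonincreasing_transfer k (chi : 'rV[R]_k) (b : nat) (e : R) :
  nonincreasing chi -> (b.+1 < k)%N -> 0 < e ->
  0 <= at_eps e (entry chi b - entry chi b.+1, -2) ->
  nonincreasing (transfer chi b e).
Proof.
move=> schi bk e_gt0 gap i j ij; rewrite !mxE.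
case: (eqVneq i j) => [->//|neq_ij].
have {ij neq_ij} ij : (i < j)%N by rewrite ltn_neqAle ij andbT.
have chiS : entry chi b - entry chi b.+1 >= 2 * e.
  by move: gap; rewrite /at_eps /=; lra.
have bk' := ltnW bk.
rewrite (entry_ord chi (Ordinal bk)) (entry_ord chi (Ordinal bk')) in chiS.
rewrite !directionE.
have [jb|jb] := eqVneq (j : nat) b.+1; have [ib|ib] := eqVneq (i : nat) b.
- have -> : j = Ordinal bk by exact: val_inj.
  have -> : i = Ordinal bk' by exact: val_inj.
  by rewrite /= ltn_eqF //; lra.
- have -> : j = Ordinal bk by exact: val_inj.
  have : chi 0 (Ordinal bk') <= chi 0 i.
    by apply: schi; rewrite /= -ltnS -jb.
  have -> : (i == b.+1 :> nat) = false by rewrite -jb ltn_eqF.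
  by lra.
- have -> : i = Ordinal bk' by exact: val_inj.
  have : chi 0 j <= chi 0 (Ordinal bk) by apply: schi; rewrite /= -ib.
  have -> : (j == b :> nat) = false by rewrite -ib gtn_eqF.
  by rewrite /= ltn_eqF //; lra.
- have cij := schi _ _ (ltnW ij).
  by case: (i == b.+1 :> nat); case: (j == b :> nat); lra.
Qed.

Lemma recoverableP n k (psi phi : 'rV[R]_n) (chi : 'rV[R]_k) :
  schmidt_vector psi -> schmidt_vector phi -> schmidt_vector chi ->
  recoverable psi phi chi <->
  recovery_test n k (entry psi) (entry phi) (entry chi).
Proof.
move=> [_ psi0 psi1] [_ phi0 phi1] [schi chi0 chi1]; split.
  case=> omega [[som om0 om1] maj_om om_chi neq].
  have [b [bk chi_b gap]] := strict_gap_exists schi som om_chi neq.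
  apply/hasP; exists b; first by rewrite mem_iota add0n ltn_predRL.
  rewrite /transfer_ok chi_b /=.
  (* Three demands on [e]: the margins are decided ([e1]), the transfer keeps the order ([e2]), and
     it does not fall below omega in majorization ([e3]). *)
  have [e1 e1_gt0 He1] := small_eps psi phi chi b.
  have [e2 e2_gt0 He2] := lex_nneg_at_eps (entry chi b - entry chi b.+1, -2).
  have [e3 e3_gt0 He3] :=
    lex_nneg_at_eps (prefix_sum chi b.+1 - prefix_sum omega b.+1, -1).
  pose e := Num.min e1 (Num.min e2 e3).
  have e_gt0 : 0 < e by rewrite !lt_min e1_gt0 e2_gt0.
  have /and3P[ee1 ee2 ee3] : [&& e <= e1, e <= e2 & e <= e3].
    by have := lexx e; rewrite {2}/e !le_min.
  have str : nonincreasing (transfer chi b e).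
    apply: nonincreasing_transfer => //.
    by rewrite He2 // /lex_nneg /= subr_gt0 chi_b.
  have om_tr : omega ≺ transfer chi b e.
    case: om_chi => le_l eq_s; split=> [l lk|]; last by rewrite sum_transfer.
    rewrite !sum_largest_nonincreasing // prefix_sum_transfer //.
    have := le_l l lk; rewrite !sum_largest_nonincreasing //.
    case: eqP => [->|_]; rewrite ?mulr1n ?mulr0n ?subr0 // => _.
    have : 0 <= at_eps e (prefix_sum chi b.+1 - prefix_sum omega b.+1, -1).
      by rewrite He3 // /lex_nneg /= subr_gt0 gap.
    by rewrite /at_eps /=; lra.
  have maj_tr := majorized_kron_trans phi0 maj_om om_tr.
  apply/allP => a; rewrite mem_iota add0n => /= an.
  apply/allP => c; rewrite mem_iota add0n => /= ck.
  rewrite -[a]/(val (Ordinal an)) -[c]/(val (Ordinal ck)) (He1 e) //.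
  exact: majorized_hinge.
case/hasP => b; rewrite mem_iota add0n ltn_predRL => bk /andP[chi_b /allP ok].
have [e1 e1_gt0 He1] := small_eps psi phi chi b.
have [e2 e2_gt0 He2] := lex_nneg_at_eps (entry chi b - entry chi b.+1, -2).
pose e := Num.min e1 e2.
have e_gt0 : 0 < e by rewrite !lt_min e1_gt0 e2_gt0.
have /andP[ee1 ee2] : (e <= e1) && (e <= e2).
  by have := lexx e; rewrite {2}/e !le_min.
have str : nonincreasing (transfer chi b e).
  apply: nonincreasing_transfer => //.
  by rewrite He2 // /lex_nneg /= subr_gt0 chi_b.
exists (transfer chi b e); split.
- split=> // [j|]; last by rewrite sum_transfer.
  have := He2 e e_gt0 ee2; rewrite /lex_nneg /= subr_gt0 chi_b /=.
  rewrite /at_eps /= (entry_ord chi (Ordinal bk)).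
  rewrite (entry_ord chi (Ordinal (ltnW bk))) => gap.
  (* Only entry [b] decreases, and by [gap] it stays above entry [b.+1] of [chi], which is
     nonnegative. *)
  have := chi0 (Ordinal bk); have := chi0 j; rewrite !mxE directionE.
  case: (eqVneq (j : nat) b.+1) => [_|_]; first by nra.
  case: (eqVneq (j : nat) b) => [jb|_]; last by lra.
  have -> : j = Ordinal (ltnW bk) by exact: val_inj.
  by lra.
- apply: hinge_majorized => [|q].
    by rewrite !sum_kronE sum_transfer // psi1 phi1.
  suff [a [c ->]] : exists a c,
      kron phi (transfer chi b e) 0 q = phi 0 a * transfer chi b e 0 c.
    by rewrite -He1 //; apply: (allP (ok a _)); rewrite mem_iota add0n ltn_ord.
  case: (mxtens_indexP q) => a c; exists a, c.
  rewrite -[LHS]/((phi *t transfer chi b e) 0 (mxtens_index (a, c))) -tensmxE.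
  by congr (fun_of_matrix _ _ _); exact: val_inj.
- split=> [l lk|]; last by rewrite sum_transfer.
  rewrite !sum_largest_nonincreasing // prefix_sum_transfer //.
  by rewrite lerBlDr lerDl mulrn_wge0 // ltW.
- move=> /rowP/(_ (Ordinal bk)); rewrite mxE directionE /= eqxx mulr1.
  by lra.
Qed.

End Decision.

(** * Time-bounded total-correctness triples for the real RAM *)

Section TimedTriples.
Variable R : realType.
Implicit Types (s : state R) (p q : program) (P Q : state R -> Prop).

Definition takes (T : nat) P p Q : Prop :=
  forall s, P s -> exists t s', [/\ exec p s t s', t <= T & Q s'].

Lemma takes_weaken T' T P p Q : takes T' P p Q -> T' <= T -> takes T P p Q.
Proof.
move=> Pp T'T s /Pp[t [s' [ex tT Qs']]]; exists t, s'; split=> //.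
exact: leq_trans T'T.
Qed.

Lemma takes_seq T1 T2 P Q S p q :
  takes T1 P p Q -> takes T2 Q q S -> takes (T1 + T2) P (Seq p q) S.
Proof.
move=> Pp Qq s /Pp[t1 [s1 [ex1 t1T /Qq[t2 [s2 [ex2 t2T Ss2]]]]]].
by exists (t1 + t2), s2; split; [apply: ExecSeq ex1 ex2|exact: leq_add|].
Qed.

Fixpoint loop_free p : bool :=
  match p with
  | Seq p q | If _ p q => loop_free p && loop_free q
  | While _ _ => false
  | _ => true
  end.

Fixpoint cost p : nat :=
  match p with
  | Seq p q => cost p + cost q
  | If _ p q => (maxn (cost p) (cost q)).+1
  | _ => 1
  end.

(** Straight-line code is verified by computing its final state. The values of [run] and [cost] on
    [While] are placeholders, excluded by [loop_free]. *)
Fixpoint run p s : state R :=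
  match p with
  | Seq p q => run q (run p s)
  | IndexConst r m => set_reg s r m
  | IndexAdd r r1 r2 => set_reg s r (reg s r1 + reg s r2)
  | IndexSub r r1 r2 => set_reg s r (reg s r1 - reg s r2)
  | RealConst d m => write s d m%:R
  | RealOp f d o1 o2 => write s d (eval_op f (read s o1) (read s o2))
  | If b p q => if eval_test s b then run p s else run q s
  | Skip | While _ _ => s
  end.

Lemma exec_run p s : loop_free p ->
  exists2 t, t <= cost p & exec p s t (run p s).
Proof.
elim: p s => [|p IHp q IHq|r m|r r1 r2|r r1 r2|d m|f d o1 o2|b p IHp q IHq|//]
  s /=;
  try by exists 1 => //; constructor.
- case/andP=> /(IHp s)[t1 t1p ex1] /(IHq (run p s))[t2 t2q ex2].
  by exists (t1 + t2); [exact: leq_add|apply: ExecSeq ex1 ex2].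
- case/andP=> /(IHp s)[t1 t1p ex1] /(IHq s)[t2 t2q ex2].
  have [b_true|b_false] := boolP (eval_test s b).
    exists t1.+1; first by rewrite ltnS leq_max t1p.
    exact: ExecIfTrue.
  exists t2.+1; first by rewrite ltnS leq_max t2q orbT.
  exact: ExecIfFalse.
Qed.

Lemma takes_run P p Q :
  loop_free p -> (forall s, P s -> Q (run p s)) -> takes (cost p) P p Q.
Proof.
move=> lf PQ s Ps; have [t tp ex] := exec_run s lf.
by exists t, (run p s); split=> //; exact: PQ.
Qed.

(* Register 3 is expected to hold 1. *)
Definition for_loop (r bound : nat) (body : program) : program :=
  Seq (IndexConst r 0)
      (While (IndexLt r bound) (Seq body (IndexAdd r r 3))).

(** Each round pays 2 steps for the test and the increment; the final 2 are the initialisation and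
    the failing test. The body must establish the invariant for the state after the increment. *)
Lemma takes_for (I : nat -> state R -> Prop) N T r bound body P Q :
  (forall s, P s -> I 0 (set_reg s r 0)) ->
  (forall i s, I i s -> reg s r = i /\ reg s bound = N) ->
  (forall i, i < N ->
     takes T (I i) body (fun s => I i.+1 (set_reg s r (reg s r + reg s 3)))) ->
  (forall s, I N s -> Q s) ->
  takes (N * (T + 2) + 2) P (for_loop r bound body) Q.
Proof.
move=> init ctr step fin s /init.
suff loop m i s1 : i + m = N -> I i s1 -> exists t s2,
    [/\ exec (While (IndexLt r bound) (Seq body (IndexAdd r r 3))) s1 t s2,
        t <= m * (T + 2) + 1 & Q s2].
  case/(loop N 0) => // t [s2 [ex tT Qs2]].
  exists (1 + t), s2; split=> //; last by lia.
  exact: ExecSeq (ExecIndexConst _ _ _) ex.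
elim: m i s1 => [|m IH] i s1 imN Ii; have [r_i bN] := ctr _ _ Ii.
  rewrite addn0 in imN; rewrite imN in r_i Ii.
  exists 1, s1; split; [|by rewrite mul0n|exact: fin Ii].
  by apply: ExecWhileFalse; rewrite /= r_i bN ltnn.
have iN : i < N by rewrite -imN addnS ltnS leq_addr.
have [t1 [s2 [ex1 t1T]]] := step i iN s1 Ii.
rewrite addnS -addSn in imN.
case/(IH _ _ imN) => t2 [s3 [ex2 t2T Qs3]].
exists (t1 + 1 + t2).+1, s3; split=> //; last by nia.
apply: ExecWhileTrue ex2; first by rewrite /= r_i bN.
exact: ExecSeq ex1 (ExecIndexAdd _ _ _ _).
Qed.

End TimedTriples.

(** * The decision program and its memory layout *)

(* Registers: 0 is n, 1 is k, 2 holds 0, 3 holds 1, 4 holds k - 1, and 5 to 9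
   are the loop counters b, a, c, i, j; 10 is the answer, 11 records whether
   the transfer at b still qualifies, and 12 holds b + 1.
   Arrays: 0, 1 and 2 are psi, phi and chi, and 3 is the direction of the
   transfer; 4 to 10 are used as scalars: 4 holds 0, and (5, 6), (7, 8) and
   (9, 10) are infinitesimal pairs holding the threshold, the margin and the
   current difference. *)
Definition add_pos_part (f : real_op) : program :=
  If (RealLe (9, 2) (4, 2))
     (If (RealLe (4, 2) (9, 2))
         (If (RealLe (4, 2) (10, 2)) (RealOp f (8, 2) (8, 2) (10, 2)) Skip)
         Skip)
     (Seq (RealOp f (7, 2) (7, 2) (9, 2)) (RealOp f (8, 2) (8, 2) (10, 2))).

Definition source_difference : program :=
  Seq (RealOp RMul (9, 2) (0, 8) (2, 9))
  (Seq (RealOp RSub (9, 2) (9, 2) (5, 2))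
       (RealOp RSub (10, 2) (4, 2) (6, 2))).

Definition target_difference : program :=
  Seq (RealOp RMul (9, 2) (1, 8) (2, 9))
  (Seq (RealOp RSub (9, 2) (9, 2) (5, 2))
  (Seq (RealOp RMul (10, 2) (1, 8) (3, 9))
       (RealOp RSub (10, 2) (10, 2) (6, 2)))).

Definition add_term : program :=
  Seq source_difference
  (Seq (add_pos_part RSub)
  (Seq target_difference
       (add_pos_part RAdd))).

Definition set_threshold : program :=
  Seq (RealOp RMul (5, 2) (1, 6) (2, 7))
  (Seq (RealOp RMul (6, 2) (1, 6) (3, 7))
  (Seq (RealConst (7, 2) 0)
       (RealConst (8, 2) 0))).

(** Real tests offer only [<=], so a lexicographic sign takes up to three of them: a positive first
    component shows as a failed test, a zero one as two successes. *)
Definition check_margin : program :=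
  If (RealLe (7, 2) (4, 2))
     (If (RealLe (4, 2) (7, 2))
         (If (RealLe (4, 2) (8, 2)) Skip (IndexConst 11 0))
         (IndexConst 11 0))
     Skip.

Definition test_threshold : program :=
  Seq set_threshold
  (Seq (for_loop 8 0 (for_loop 9 1 add_term))
       check_margin).

(** Literals are natural numbers, so -1 is computed as 0 - 1, with array 9 as scratch space. *)
Definition set_direction : program :=
  Seq (IndexAdd 12 5 3)
  (Seq (RealConst (3, 12) 1)
  (Seq (RealConst (9, 2) 1)
  (Seq (RealOp RSub (3, 5) (4, 2) (9, 2))
       (IndexConst 11 1)))).

(** The strict descent of chi at [b] is checked only here, after the margins. The two direction
    entries are then cleared for the next [b]. *)
Definition conclude_transfer : program :=
  Seq (If (RealLe (2, 5) (2, 12)) Skip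
          (If (IndexLt 11 3) Skip (IndexConst 10 1)))
  (Seq (RealConst (3, 5) 0)
       (RealConst (3, 12) 0)).

Definition test_transfer : program :=
  Seq set_direction
  (Seq (for_loop 6 0 (for_loop 7 1 test_threshold))
       conclude_transfer).

(** Register 0 holds the loop bound [n] until the end, when adding register 2, which is 0, copies
    the answer into it. *)
Definition recovery_program : program :=
  Seq (Seq (IndexConst 3 1) (IndexSub 4 1 3))
  (Seq (for_loop 5 4 test_transfer)
       (IndexAdd 0 10 2)).

(** * Correctness and running time of the program *)

Section Correctness.
Local Open Scope ring_scope.
Variables (R : realType) (n k : nat) (x y z : nat -> R).
Hypotheses (n_gt0 : (0 < n)%N) (k_gt0 : (0 < k)%N).

(** Arrays are described pointwise, which avoids functional extensionality; the scalar arrays are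
    constrained at index 0 only. *)
Definition memory (rho : seq nat) (v : seq R) (d : nat -> R) (s : state R) :=
  [/\ mkseq (reg s) 13 = rho, [/\ arr s 0 =1 x, arr s 1 =1 y & arr s 2 =1 z],
      arr s 3 =1 d & [seq arr s m 0 | m <- iota 4 7] = v].

Definition regs (b bS a c i j : nat) (flag ok : bool) : seq nat :=
  [:: n; k; 0%N; 1%N; (k - 1)%N; b; a; c; i; j; nat_of_bool flag;
      nat_of_bool ok; bS].

Definition vals (t F u : R * R) : seq R :=
  [:: 0; t.1; t.2; F.1; F.2; u.1; u.2].

(** The program skips zero contributions; the hypothesis on [f] makes this agree with operating by
    0. *)
Lemma takes_add_pos_part f b bS a c i j flag ok t F u d :
  (forall w, eval_op f w 0 = w :> R) ->
  takes 4 (memory (regs b bS a c i j flag ok) (vals t F u) d) (add_pos_part f)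
    (memory (regs b bS a c i j flag ok)
       (vals t (eval_op f F.1 (lex_pos_part u).1,
                eval_op f F.2 (lex_pos_part u).2) u) d).
Proof.
move=> f0; apply: (@takes_run _ _ (add_pos_part f)) => // s [Hr Hin Hd Hv].
have [_ _ r2 _ _ _ _ _ _ _ _ _ _] := Hr.
have [v4 v5 v6 v7 v8 v9 v10] := Hv.
rewrite /run /= /read /= r2 v4 v9 v10 /lex_pos_part /lex_nneg.
case: (ltgtP u.1 0) => u1 /=; rewrite ?f0.
- by split=> //; rewrite Hv.
- by split=> //; rewrite /= r2 /= v4 v5 v6 v7 v8 v9 v10.
- case: ifP => _; rewrite /= ?u1 ?f0.
    by split=> //; rewrite /= r2 /= v4 v5 v6 v7 v8 v9 v10.
  by split=> //; rewrite Hv.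
Qed.

Lemma takes_source_difference b bS a c i j flag ok t F u d :
  takes 3 (memory (regs b bS a c i j flag ok) (vals t F u) d)
    source_difference
    (memory (regs b bS a c i j flag ok) (vals t F (source x z i j - t)) d).
Proof.
apply: (@takes_run _ _ source_difference) => // s [Hr [Hx Hy Hz] Hd Hv].
have [_ _ r2 _ _ _ _ _ r8 r9 _ _ _] := Hr.
have [v4 v5 v6 v7 v8 v9 v10] := Hv.
rewrite /run /= /read /= r2 r8 r9 /= Hx Hz v4 v5 v6.
by split=> //; rewrite /= ?r2 /= v4 v5 v6 v7 v8.
Qed.

Lemma takes_target_difference b bS a c i j flag ok t F u :
  takes 4 (memory (regs b bS a c i j flag ok) (vals t F u) (direction R b))
    target_difference
    (memory (regs b bS a c i j flag ok) (vals t F (target y z b i j - t))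
       (direction R b)).
Proof.
apply: (@takes_run _ _ target_difference) => // s [Hr [Hx Hy Hz] Hd Hv].
have [_ _ r2 _ _ _ _ _ r8 r9 _ _ _] := Hr.
have [v4 v5 v6 v7 v8 v9 v10] := Hv.
rewrite /run /= /read /= r2 r8 r9 /= Hy Hz Hd v5 v6.
by split=> //; rewrite /= ?r2 /= v4 v5 v6 v7 v8.
Qed.

Lemma takes_add_term b bS a c i j flag ok F u :
  takes 15
    (memory (regs b bS a c i j flag ok) (vals (target y z b a c) F u)
       (direction R b))
    add_term
    (fun s => exists u', memory (regs b bS a c i j flag ok)
       (vals (target y z b a c) (F + margin_term x y z b a c i j) u')
       (direction R b) s).
Proof.
apply: (takes_weaken (T' := 3 + (4 + (4 + 4)))) => //.
apply: takes_seq; first exact: takes_source_difference.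
apply: takes_seq; first by apply: takes_add_pos_part => w /=; rewrite subr0.
apply: takes_seq; first exact: takes_target_difference.
move=> s /(takes_add_pos_part (f := RAdd)) [w|t [s' [ex t4 Hs']]].
  exact: addr0.
exists t, s'; split=> //.
exists (target y z b i j - target y z b a c).
move: Hs'; rewrite /margin_term.
set p := lex_pos_part (target _ _ _ _ _ - _).
set q := lex_pos_part (source _ _ _ _ - _).
(* The program first subtracts the source part and then adds the target part. *)
suff -> : F + (p - q) =
  (eval_op RAdd (eval_op RSub F.1 q.1) p.1,
   eval_op RAdd (eval_op RSub F.2 q.2) p.2) by [].
case: F p q => [F1 F2] [p1 p2] [q1 q2] /=.
by congr (_, _); rewrite addrCA addrC.
Qed.

(** The counter and the scratch pair are existential because the enclosing loop re-enters with stale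
    values. *)
Lemma takes_entry_loop b bS a c i flag ok F :
  takes (k * 17 + 2)
    (fun s => exists j u, memory (regs b bS a c i j flag ok)
       (vals (target y z b a c) F u) (direction R b) s)
    (for_loop 9 1 add_term)
    (fun s => exists j u, memory (regs b bS a c i j flag ok)
       (vals (target y z b a c)
          (F + \sum_(0 <= j' < k) margin_term x y z b a c i j') u)
       (direction R b) s).
Proof.
pose I (j : nat) (s : state R) := exists u,
  memory (regs b bS a c i j flag ok)
    (vals (target y z b a c)
       (F + \sum_(0 <= j' < j) margin_term x y z b a c i j') u)
    (direction R b) s.
apply: (takes_for (I := I) (T := 15)).
- move=> s [j [u [Hr Hin Hd Hv]]]; exists u; split=> //.
    2: by rewrite big_geq // addr0.
  by case: Hr => *; rewrite /mkseq /regs /=; congruence.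
- by move=> j s [u [Hr _ _ _]]; case: Hr => *.
- move=> j jk s [u /takes_add_term [t [s' [ex t15 [u' [Hr Hin Hd Hv]]]]]].
  exists t, s'; split=> //; exists u'; split=> //.
    by case: Hr => *; rewrite /mkseq /regs -[j.+1]addn1 /=; congruence.
  by rewrite big_nat_recr //= addrA.
- by move=> s Is; exists k.
Qed.

Lemma takes_margin_loop b bS a c flag ok :
  takes (n * (k * 17 + 4) + 2)
    (fun s => exists i j u, memory (regs b bS a c i j flag ok)
       (vals (target y z b a c) 0 u) (direction R b) s)
    (for_loop 8 0 (for_loop 9 1 add_term))
    (fun s => exists i j u, memory (regs b bS a c i j flag ok)
       (vals (target y z b a c) (margin n k x y z b a c) u)
       (direction R b) s).
Proof.
pose I (i : nat) (s : state R) := exists j u,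
  memory (regs b bS a c i j flag ok)
    (vals (target y z b a c)
       (\sum_(0 <= i' < i) \sum_(0 <= j' < k) margin_term x y z b a c i' j') u)
    (direction R b) s.
apply: (takes_weaken (T' := n * (k * 17 + 2 + 2) + 2)); last by rewrite -addnA.
apply: (takes_for (I := I)).
- move=> s [i [j [u [Hr Hin Hd Hv]]]]; exists j, u; split=> //.
    2: by rewrite big_geq.
  by case: Hr => *; rewrite /mkseq /regs /=; congruence.
- by move=> i s [j [u [Hr _ _ _]]]; case: Hr => *.
- move=> i ik s /takes_entry_loop [t [s' [ex t15 [j [u [Hr Hin Hd Hv]]]]]].
  exists t, s'; split=> //; exists j, u; split=> //.
    by case: Hr => *; rewrite /mkseq /regs -[i.+1]addn1 /=; congruence.
  by rewrite big_nat_recr.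
- by move=> s Is; exists n.
Qed.

Lemma takes_test_threshold b bS a c flag ok :
  takes (n * (k * 17 + 4) + 10)
    (fun s => exists i j t F u, memory (regs b bS a c i j flag ok)
       (vals t F u) (direction R b) s)
    test_threshold
    (fun s => exists i j t F u,
       memory (regs b bS a c i j flag (ok && lex_nneg (margin n k x y z b a c)))
       (vals t F u) (direction R b) s).
Proof.
apply: (takes_weaken (T' := 4 + (n * (k * 17 + 4) + 2 + 4))); last by lia.
pose P (s : state R) := exists i j u, memory (regs b bS a c i j flag ok)
  (vals (target y z b a c) 0 u) (direction R b) s.
pose Q (s : state R) := exists i j u, memory (regs b bS a c i j flag ok)
  (vals (target y z b a c) (margin n k x y z b a c) u) (direction R b) s.
apply: (takes_seq (Q := P)); last apply: (takes_seq (Q := Q)).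
- apply: (@takes_run _ _ set_threshold) => // s.
  case=> i [j [t [F [u [Hr [Hx Hy Hz] Hd Hv]]]]].
  have [_ _ r2 _ _ _ r6 r7 _ _ _ _ _] := Hr.
  have [v4 v5 v6 v7 v8 v9 v10] := Hv.
  exists i, j, u.
  rewrite /run /set_threshold /= /read /= r6 r7 Hy Hz Hd.
  by split=> //; rewrite /= ?r2 /= v4 v9 v10.
- exact: takes_margin_loop.
- apply: (@takes_run _ _ check_margin) => // s.
  case=> i [j [u [Hr Hin Hd Hv]]]; exists i, j, (target y z b a c).
  exists (margin n k x y z b a c), u.
  have [r0 r1 r2 r3 r4 r5 r6 r7 r8 r9 r10 r11 r12] := Hr.
  have [v4 v5 v6 v7 v8 v9 v10] := Hv.
  rewrite /run /check_margin /= /read /= r2 v4 v7 v8 /lex_nneg.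
  have fail : mkseq (reg (set_reg s 11 0)) 13 =
    regs b bS a c i j flag (ok && false).
    by rewrite andbF /mkseq /regs /=; congruence.
  case: (ltgtP (margin n k x y z b a c).1 0) => _ /=.
  + by split.
  + by rewrite andbT; split.
  + by case: ifP => _; rewrite ?andbT; split.
Qed.

Definition row_ok (b a : nat) : bool :=
  all (fun c => lex_nneg (margin n k x y z b a c)) (iota 0 k).

Lemma takes_column_loop b bS a flag ok :
  takes (k * (n * (k * 17 + 4) + 12) + 2)
    (fun s => exists c i j t F u, memory (regs b bS a c i j flag ok)
       (vals t F u) (direction R b) s)
    (for_loop 7 1 test_threshold)
    (fun s => exists c i j t F u,
       memory (regs b bS a c i j flag (ok && row_ok b a))
       (vals t F u) (direction R b) s).
Proof.
pose I (c : nat) (s : state R) := exists i j t F u,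
  memory (regs b bS a c i j flag
    (ok && all (fun c => lex_nneg (margin n k x y z b a c)) (iota 0 c)))
    (vals t F u) (direction R b) s.
apply: (takes_weaken (T' := k * (n * (k * 17 + 4) + 10 + 2) + 2)).
  2: by rewrite -addnA.
apply: (takes_for (I := I)).
- move=> s [c [i [j [t [F [u [Hr Hin Hd Hv]]]]]]].
  exists i, j, t, F, u; split=> //; rewrite andbT.
  by case: Hr => *; rewrite /mkseq /regs /=; congruence.
- by move=> c s [i [j [t [F [u [Hr _ _ _]]]]]]; case: Hr => *.
- move=> c ck s /takes_test_threshold [tm [s' [ex le_tm Hs']]].
  exists tm, s'; split=> //.
  move: Hs' => [i [j [t [F [u [Hr Hin Hd Hv]]]]]].
  exists i, j, t, F, u; split=> //.
  rewrite -[c.+1]addn1 iotaD all_cat /= add0n andbT andbA.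
  by case: Hr => *; rewrite /mkseq /regs /=; congruence.
- by move=> s Is; exists k.
Qed.

Lemma takes_row_loop b bS flag ok :
  takes (n * (k * (n * (k * 17 + 4) + 12) + 4) + 2)
    (fun s => exists a c i j t F u, memory (regs b bS a c i j flag ok)
       (vals t F u) (direction R b) s)
    (for_loop 6 0 (for_loop 7 1 test_threshold))
    (fun s => exists a c i j t F u,
       memory (regs b bS a c i j flag (ok && all (row_ok b) (iota 0 n)))
       (vals t F u) (direction R b) s).
Proof.
pose I (a : nat) (s : state R) := exists c i j t F u,
  memory (regs b bS a c i j flag (ok && all (row_ok b) (iota 0 a)))
    (vals t F u) (direction R b) s.
apply: (takes_weaken
  (T' := n * (k * (n * (k * 17 + 4) + 12) + 2 + 2) + 2)).
  2: by rewrite -[(k * _ + 2 + 2)%N]addnA.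
apply: (takes_for (I := I)).
- move=> s [a [c [i [j [t [F [u [Hr Hin Hd Hv]]]]]]]].
  exists c, i, j, t, F, u; split=> //; rewrite andbT.
  by case: Hr => *; rewrite /mkseq /regs /=; congruence.
- by move=> a s [c [i [j [t [F [u [Hr _ _ _]]]]]]]; case: Hr => *.
- move=> a an s /takes_column_loop [tm [s' [ex le_tm Hs']]].
  exists tm, s'; split=> //.
  move: Hs' => [c [i [j [t [F [u [Hr Hin Hd Hv]]]]]]].
  exists c, i, j, t, F, u; split=> //.
  rewrite -[a.+1]addn1 iotaD all_cat /= add0n andbT andbA.
  by case: Hr => *; rewrite /mkseq /regs /=; congruence.
- by move=> s Is; exists n.
Qed.

(** The direction array is zero before and after, so two writes suffice to set up each transfer. *)
Lemma takes_test_transfer b flag :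
  takes (n * (k * (n * (k * 17 + 4) + 12) + 4) + 12)
    (fun s => exists bS a c i j ok t F u,
       memory (regs b bS a c i j flag ok) (vals t F u) (fun=> 0) s)
    test_transfer
    (fun s => exists bS a c i j ok t F u,
       memory (regs b bS a c i j (flag || transfer_ok n k x y z b) ok)
       (vals t F u) (fun=> 0) s).
Proof.
pose P ok (s : state R) := exists a c i j t F u,
  memory (regs b b.+1 a c i j flag ok) (vals t F u) (direction R b) s.
apply: (takes_weaken (T' :=
  5 + (n * (k * (n * (k * 17 + 4) + 12) + 4) + 2 + 5))); last by lia.
apply: (takes_seq (Q := P true));
  last apply: (takes_seq (Q := P (all (row_ok b) (iota 0 n)))).
- apply: (@takes_run _ _ set_direction) => // s.
  case=> bS [a [c [i [j [ok [t [F [u [Hr Hin Hd Hv]]]]]]]]].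
  have [r0 r1 r2 r3 r4 r5 r6 r7 r8 r9 r10 r11 r12] := Hr.
  have [v4 v5 v6 v7 v8 v9 v10] := Hv.
  exists a, c, i, j, t, F, (1, u.2).
  rewrite /run /set_direction /= /read; split.
  + by rewrite /mkseq /regs /= -[b.+1]addn1; congruence.
  + by [].
  + move=> m; rewrite /= r2 r3 r5 /= v4 Hd directionE sub0r addn1.
    by case: (eqVneq m b) => [->|//]; rewrite ltn_eqF.
  + by rewrite /= r2 /= v4 v5 v6 v7 v8 v10.
- exact: takes_row_loop.
- apply: (@takes_run _ _ conclude_transfer) => // s.
  case=> a [c [i [j [t [F [u [Hr [Hx Hy Hz] Hd Hv]]]]]]].
  have [r0 r1 r2 r3 r4 r5 r6 r7 r8 r9 r10 r11 r12] := Hr.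
  exists b.+1, a, c, i, j, (all (row_ok b) (iota 0 n)), t, F, u.
  rewrite /run /conclude_transfer /= /read /= r3 r5 r11 r12 !Hz.
  have -> : (flag || transfer_ok n k x y z b) =
      if z b <= z b.+1 then flag
      else if (all (row_ok b) (iota 0 n) < 1)%N then flag else true.
    rewrite /transfer_ok -/(row_ok b) leNgt.
    by case: (z b.+1 < z b); case: (all _ _); rewrite ?orbT ?orbF.
  case: (z b <= z b.+1) => /=; last case: (_ < 1)%N => /=.
  all: split=> //; try by rewrite /mkseq /regs /=; congruence.
  all: move=> m; rewrite /= r5 r12 Hd directionE.
  all: by case: eqP => // _; case: eqP.
Qed.

Lemma takes_transfer_loop :
  takes ((k - 1) * (n * (k * (n * (k * 17 + 4) + 12) + 4) + 14) + 2)
    (fun s => exists b bS a c i j ok t F u,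
       memory (regs b bS a c i j false ok) (vals t F u) (fun=> 0) s)
    (for_loop 5 4 test_transfer)
    (fun s => exists b bS a c i j ok t F u,
       memory (regs b bS a c i j (recovery_test n k x y z) ok)
       (vals t F u) (fun=> 0) s).
Proof.
pose I (b : nat) (s : state R) := exists bS a c i j ok t F u,
  memory (regs b bS a c i j (has (transfer_ok n k x y z) (iota 0 b)) ok)
    (vals t F u) (fun=> 0) s.
apply: (takes_weaken (T' :=
  (k - 1) * (n * (k * (n * (k * 17 + 4) + 12) + 4) + 12 + 2) + 2)).
  2: by rewrite -[(n * _ + 12 + 2)%N]addnA.
apply: (takes_for (I := I)).
- move=> s [b [bS [a [c [i [j [ok [t [F [u [Hr Hin Hd Hv]]]]]]]]]]].
  exists bS, a, c, i, j, ok, t, F, u; split=> //.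
  by case: Hr => *; rewrite /mkseq /regs /=; congruence.
- move=> b s [bS [a [c [i [j [ok [t [F [u [Hr _ _ _]]]]]]]]]].
  by case: Hr => *.
- move=> b bk s /takes_test_transfer [tm [s' [ex le_tm Hs']]].
  exists tm, s'; split=> //.
  move: Hs' => [bS [a [c [i [j [ok [t [F [u [Hr Hin Hd Hv]]]]]]]]]].
  exists bS, a, c, i, j, ok, t, F, u; split=> //.
  rewrite -[b.+1]addn1 iotaD has_cat /= add0n orbF.
  by case: Hr => *; rewrite /mkseq /regs /=; congruence.
- by move=> s Is; rewrite /recovery_test -subn1; exists (k - 1)%N.
Qed.

Lemma takes_recovery_program :
  takes (56 * (n ^ 2 * k ^ 4))
    (fun s => [/\ reg s 0 = n, reg s 1 = k,
       forall r, (1 < r)%N -> reg s r = 0%N,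
       [/\ arr s 0 =1 x, arr s 1 =1 y & arr s 2 =1 z]
       & forall m, (2 < m)%N -> arr s m =1 fun=> 0])
    recovery_program
    (fun s => reg s 0 = recovery_test n k x y z).
Proof.
apply: (takes_weaken (T' := 2 +
  ((k - 1) * (n * (k * (n * (k * 17 + 4) + 12) + 4) + 14) + 2 + 1))).
  apply: takes_seq; last apply: takes_seq takes_transfer_loop _.
  - apply: (@takes_run _ _ (Seq (IndexConst 3 1) (IndexSub 4 1 3))) => // s.
    case=> r0 r1 rq Hin ar.
    exists 0%N, 0%N, 0%N, 0%N, 0%N, 0%N, false, 0, 0, 0.
    split=> //; last by rewrite /= !ar.
      by rewrite /mkseq /= r0 r1 !rq.
    exact: ar.
  - apply: (@takes_run _ _ (IndexAdd 0 10 2)) => // s.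
    move=> [b [bS [a [c [i [j [ok [t [F [u [Hr _ _ _]]]]]]]]]]].
    by case: Hr => *; rewrite /= -[RHS]addn0; congruence.
(* Every additive constant is absorbed by a monomial that is at least 1: 17 + 4 + 12 = 33, then 33 +
   4 = 37, 37 + 14 = 51, and 51 + 5 = 56. *)
have nk : (1 <= n * k)%N by rewrite muln_gt0 n_gt0.
have nkk : (1 <= n * k ^ 2)%N by rewrite muln_gt0 n_gt0 expn_gt0 k_gt0.
have n2k2 : (1 <= n ^ 2 * k ^ 2)%N by rewrite muln_gt0 !expn_gt0 n_gt0 k_gt0.
have n2k3 : (1 <= n ^ 2 * k ^ 3)%N by rewrite muln_gt0 !expn_gt0 n_gt0 k_gt0.
have h1 : (n * (k * 17 + 4) + 12 <= 33 * (n * k))%N by nia.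
set X := (n * (k * 17 + 4) + 12)%N in h1 *.
have h2 : (k * X + 4 <= 37 * (n * k ^ 2))%N.
  by have := leq_mul (leqnn k) h1; lia.
set Y := (k * X + 4)%N in h2 *.
have h3 : (n * Y + 14 <= 51 * (n ^ 2 * k ^ 2))%N.
  by have := leq_mul (leqnn n) h2; lia.
set Z := (n * Y + 14)%N in h3 *.
have h4 : ((k - 1) * Z <= 51 * (n ^ 2 * k ^ 3))%N.
  by have := leq_mul (leq_subr 1 k) h3; lia.
have h5 : (n ^ 2 * k ^ 3 <= n ^ 2 * k ^ 4)%N.
  by rewrite leq_mul2l leq_pexp2l ?orbT.
by lia.
Qed.

End Correctness.

Theorem theorem5p2 (R : realType) :
  exists (p : program) (C : nat),
    forall (n k : nat) (psi phi : 'rV[R]_n) (chi : 'rV[R]_k),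
      schmidt_vector psi -> schmidt_vector phi -> schmidt_vector chi ->
      psi ≺ phi ->
      exists (t : nat) (s : state R),
        [/\ exec p (input psi phi chi) t s,
            t <= C * (n ^ 2 * k ^ 4)
          & accepts s <-> recoverable psi phi chi].
Proof.
exists recovery_program, 56 => n k psi phi chi psiS phiS chiS _.
(* In dimension 0 the empty sum would have to equal 1. *)
have pos m (w : 'rV[R]_m) : schmidt_vector w -> 0 < m.
  case: m w => // w [_ _]; rewrite big_ord0 => /eqP.
  by rewrite eq_sym oner_eq0.
have [|t [s [ex le_t res]]] := @takes_recovery_program R n k
  (entry psi) (entry phi) (entry chi) (pos _ _ psiS) (pos _ _ chiS)
  (input psi phi chi).
  by split=> // [[|[|]]|[|[|[|]]]].
exists t, s; split=> //.
apply: iff_trans (iff_sym (recoverableP psiS phiS chiS)).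
by rewrite /accepts res; case: recovery_test.
Qed.
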